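(* Let $M$ be a compact, infinite and locally connected metric space. Let $\mathcal{G}$ be a finitely generated pseudo-group of local homeomorphisms of $M$. If $\mathcal{G}$ is $CW$-expansive, then $\mathcal{G}$ has positive geometric entropy.
   Context: A local homeomorphism of $X$ here is a homeomorphism $h:D_h\to R_h$ between open subsets of $X$. A pseudo-group $\mathcal{G}$ on $X$ is a family of local homeomorphisms of $X$ such that: (1) if $h,g\in\mathcal{G}$ and $D_g\subset R_h$, then $g\circ h\in\mathcal{G}$; (2) if $g\in\mathcal{G}$ then $g^{-1}\in\mathcal{G}$; (3) if $g\in\mathcal{G}$ and $U\subset D_g$ is open, then $g|_U\in\mathcal{G}$; (4) if $g$ is a local homeomorphism of $X$ and $\mathcal{U}$ is an open cover of $D_g$ such that $g|_U\in\mathcal{G}$ for all $U\in\mathcal U$, then $g\in\mathcal{G}$; (5) $\mathrm{Id}_X\in\mathcal{G}$. A set $\Gamma$ of local homeomorphisms with $\bigcup_{g\in\Gamma}(D_g\cup R_g)=X$ generates a pseudo-group $\mathcal{G}(\Gamma)$: for any $g\in\mathcal{G}(\Gamma)$ and $x\in D_g$ there are $g_1,\dots,g_i\in\Gamma$, $e_1,\dots,e_i\in\{-1,1\}$ and a neighborhood $U$ of $x$ with $g|_U=g_i^{e_i}\circ\cdots\circ g_1^{e_1}|_U$. $\mathcal{G}$ is finitely generated if $\mathcal{G}=\mathcal{G}(\Gamma)$ for some finite $\Gamma\subset\mathcal{G}$ (a finite generator). $CW$-expansiveness: $\mathcal{G}$ is $CW$-expansive if there is $\delta>0$ such that for every compact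 connected set $C\subset M$ with more than one point there is $g\in\mathcal{G}$ with $C\subset D_g$ and $\mathrm{diam}(g(C))>\delta$. Geometric entropy: let $G$ be a finite generator of $\mathcal{G}$. For $g\in\mathcal{G}$, $\#g=k$ means that $k$ is the minimal number of elements of $G$ (or inverses of such) whose composition equals $g$ (on $D_g$). Points $x,y\in M$ are $n$-$\varepsilon$-$G$-separated if there is $g\in\mathcal{G}$ with $x,y\in D_g$, $\#g\le n$ and $d(g(x),g(y))>\varepsilon$. A subset $E\subset M$ is $n$-$\varepsilon$-$G$-separated if every pair of distinct points of $E$ is. Let $S(n,\varepsilon,G)$ be the maximal cardinality of an $n$-$\varepsilon$-$G$-separated subset of $M$, and $$h(\mathcal{G},G)=\lim_{\varepsilon\to0}\limsup_{n\to\infty}\frac1n\log S(n,\varepsilon,G).$$ It is a classical fact that positivity of $h(\mathcal{G},G)$ does not depend on the choice of finite generator $G$; $\mathcal{G}$ has positive geometric entropy if $h(\mathcal{G},G)>0$. *)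

(* Defs.v *)
From HB Require Import structures.
From mathcomp Require Import all_boot all_order all_algebra.
From mathcomp Require Import all_classical all_reals all_analysis.

Set Implicit Arguments.
Unset Strict Implicit.
Unset Printing Implicit Defensive.

Import Order.TTheory GRing.Theory Num.Theory.
Import numFieldNormedType.Exports.

Local Open Scope classical_set_scope.
Local Open Scope ring_scope.

Definition locally_connected (T : topologicalType) : Prop :=
  forall (x : T) (A : set T), nbhs x A ->
  exists U : set T, [/\ open U, connected U, U x & U `<=` A].

(* A homeomorphism between two open subsets of T, bundled with its inverse.
   Both maps are total functions whose values outside lh_dom (resp. lh_ran)
   are junk, so the intended equality is [same_map], not Leibniz equality. *)
Record local_homeo (T : topologicalType) := LocalHomeo {
  lh_dom : set T;
  lh_ran : set T;
  lh_fun :> T -> T;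
  lh_invfun : T -> T;
  lh_dom_open : open lh_dom;
  lh_ran_open : open lh_ran;
  lh_fun_ran : forall x, lh_dom x -> lh_ran (lh_fun x);
  lh_inv_dom : forall y, lh_ran y -> lh_dom (lh_invfun y);
  lh_funK : forall x, lh_dom x -> lh_invfun (lh_fun x) = x;
  lh_invK : forall y, lh_ran y -> lh_fun (lh_invfun y) = y;
  lh_fun_cont : {within lh_dom, continuous lh_fun};
  lh_inv_cont : {within lh_ran, continuous lh_invfun}
}.

Lemma open_preimage_within (T S : topologicalType) (D : set T) (V : set S)
    (f : T -> S) :
  open D -> {within D, continuous f} -> open V -> open (D `&` f @^-1` V).
Proof.
by move=> oD; rewrite continuous_open_subspace// => /continuous_inP; exact.
Qed.

Lemma within_continuous_comp (T S Z : topologicalType) (A : set T) (B : set S)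
    (f : T -> S) (g : S -> Z) :
  open A -> open B -> {within A, continuous f} -> {within B, continuous g} ->
  {within A `&` f @^-1` B, continuous (g \o f)}.
Proof.
move=> oA oB cf cg; have oAB := open_preimage_within oA cf oB.
move: cf cg; rewrite !continuous_open_subspace// => cf cg x.
rewrite inE => -[Ax Bfx]; apply: continuous_comp.
- by apply: cf; rewrite inE.
- by apply: cg; rewrite inE.
Qed.

Section local_homeo_operations.
Context {T : topologicalType}.
Implicit Types (f g h : local_homeo T) (U : set T).

Definition same_map g h : Prop :=
  lh_dom g = lh_dom h /\ forall x, lh_dom g x -> g x = h x.

Definition lh_id : local_homeo T :=
  @LocalHomeo T setT setT id id openT openT
    (fun=> id) (fun=> id) (fun=> fun=> erefl) (fun=> fun=> erefl)
    (continuous_subspaceT (fun x => cvg_id))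
    (continuous_subspaceT (fun x => cvg_id)).

Definition lh_inv g : local_homeo T :=
  LocalHomeo (lh_ran_open g) (lh_dom_open g)
    (@lh_inv_dom _ g) (@lh_fun_ran _ g) (@lh_invK _ g) (@lh_funK _ g)
    (@lh_inv_cont _ g) (@lh_fun_cont _ g).

(* [lh_comp g h] is g o h on its natural domain h^-1(D_g). *)
Definition lh_comp g h : local_homeo T.
Proof.
refine (@LocalHomeo T
    (lh_dom h `&` h @^-1` lh_dom g)
    (lh_ran g `&` lh_invfun g @^-1` lh_ran h)
    (g \o h) (lh_invfun h \o lh_invfun g) _ _ _ _ _ _ _ _).
- exact: open_preimage_within (lh_dom_open h) (@lh_fun_cont _ h) (lh_dom_open g).
- exact: open_preimage_within (lh_ran_open g) (@lh_inv_cont _ g) (lh_ran_open h).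
- move=> x [hx ghx].
  by split; [exact: lh_fun_ran|rewrite /= lh_funK//; exact: lh_fun_ran].
- move=> y [gy hgy].
  by split; [exact: lh_inv_dom|rewrite /= lh_invK//; exact: lh_inv_dom].
- by move=> x [hx ghx] /=; rewrite !lh_funK.
- by move=> y [gy hgy] /=; rewrite !lh_invK.
- exact: within_continuous_comp (lh_dom_open h) (lh_dom_open g)
    (@lh_fun_cont _ h) (@lh_fun_cont _ g).
- exact: within_continuous_comp (lh_ran_open g) (lh_ran_open h)
    (@lh_inv_cont _ g) (@lh_inv_cont _ h).
Defined.

Definition lh_restr g U (oU : open U) : local_homeo T.
Proof.
refine (@LocalHomeo T (lh_dom g `&` U) (lh_ran g `&` lh_invfun g @^-1` U)
    g (lh_invfun g) _ _ _ _ _ _ _ _).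
- by apply: openI => //; exact: lh_dom_open.
- exact: open_preimage_within (lh_ran_open g) (@lh_inv_cont _ g) oU.
- by move=> x [gx Ux]; split; [exact: lh_fun_ran|rewrite /= lh_funK].
- by move=> y [gy Uy]; split => //; exact: lh_inv_dom.
- by move=> x [gx Ux]; rewrite lh_funK.
- by move=> y [gy Uy]; rewrite lh_invK.
- by apply: continuous_subspaceW (@lh_fun_cont _ g) => x [].
- by apply: continuous_subspaceW (@lh_inv_cont _ g) => x [].
Defined.

(* The first field makes a pseudo-group a family of maps in spite of the junk
   values carried by [local_homeo]. *)
Record pseudogroup (G : set (local_homeo T)) : Prop := Pseudogroup {
  pg_same_map : forall g h, same_map g h -> G g -> G h;
  pg_comp : forall g h, G h -> G g -> lh_dom g `<=` lh_ran h ->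
    G (lh_comp g h);
  pg_inv : forall g, G g -> G (lh_inv g);
  pg_restr : forall g U (oU : open U), G g -> U `<=` lh_dom g ->
    G (lh_restr g oU);
  pg_glue : forall g (C : set (set T)),
    (forall U, C U -> open U /\ U `<=` lh_dom g) ->
    \bigcup_(U in C) U = lh_dom g ->
    (forall U (oU : open U), C U -> G (lh_restr g oU)) ->
    G g;
  pg_id : G lh_id
}.

(* A letter (g, true) stands for g and (g, false) for g^-1; the word
   [:: l1; ...; lk] is applied from left to right, i.e. it denotes
   lk o ... o l1 on its natural domain. *)
Definition letter_map (l : local_homeo T * bool) : local_homeo T :=
  if l.2 then l.1 else lh_inv l.1.

Fixpoint word_map (w : seq (local_homeo T * bool)) : local_homeo T :=
  if w is l :: w' then lh_comp (word_map w') (letter_map l) else lh_id.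

Fixpoint word_in (Gamma : set (local_homeo T))
    (w : seq (local_homeo T * bool)) : Prop :=
  if w is l :: w' then Gamma l.1 /\ word_in Gamma w' else True.

Definition generated_by (Gamma : set (local_homeo T)) : set (local_homeo T) :=
  [set g | forall x, lh_dom g x -> exists w, word_in Gamma w /\
     \forall y \near x,
       [/\ lh_dom g y, lh_dom (word_map w) y & g y = word_map w y]].

Definition finite_generator (G Gamma : set (local_homeo T)) : Prop :=
  [/\ finite_set Gamma, Gamma `<=` G,
      \bigcup_(g in Gamma) (lh_dom g `|` lh_ran g) = setT &
      G = generated_by Gamma].

Definition finitely_generated (G : set (local_homeo T)) : Prop :=
  exists Gamma, finite_generator G Gamma.

(* g is, on the whole of D_g, a composition of k elements of Gamma or inverses
   of such; k = 0 is the identity. *)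
Definition composition_of (Gamma : set (local_homeo T)) g (k : nat) : Prop :=
  exists w, [/\ word_in Gamma w, size w = k,
    lh_dom g `<=` lh_dom (word_map w) &
    forall x, lh_dom g x -> g x = word_map w x].

(* #g = k; an element of the pseudo-group which is only locally a composition
   of generators has no length. *)
Definition has_length (Gamma : set (local_homeo T)) g (k : nat) : Prop :=
  composition_of Gamma g k /\
  forall j, composition_of Gamma g j -> (k <= j)%N.

End local_homeo_operations.

Section metric.
Context {R : realType} {M : metricType R}.
Implicit Types (G Gamma : set (local_homeo M)) (E : set M) (x y : M).

Definition diam (A : set M) : \bar R :=
  ereal_sup [set (mdist p.1 p.2)%:E | p in A `*` A].

Definition cw_expansive G : Prop :=
  exists2 delta : R, 0 < delta &
  forall C : set M, compact C -> connected C ->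
    (exists x y, [/\ C x, C y & x <> y]) ->
    exists g, [/\ G g, C `<=` lh_dom g & (delta%:E < diam (g @` C))%E].

Definition separated_pts G Gamma (n : nat) (eps : R) x y : Prop :=
  exists g, [/\ G g, lh_dom g x, lh_dom g y,
    exists2 k, has_length Gamma g k & (k <= n)%N &
    eps < mdist (g x) (g y)].

Definition separated_in G Gamma (n : nat) (eps : R) E : Prop :=
  forall x y, E x -> E y -> x <> y -> separated_pts G Gamma n eps x y.

(* Finite subsets suffice: an infinite separated set has separated subsets of
   every finite cardinality, and the supremum is then +oo. *)
Definition max_separated G Gamma (n : nat) (eps : R) : \bar R :=
  ereal_sup [set (k%:R)%:E | k in
    [set k : nat | exists E, (E #= `I_k)%card /\ separated_in G Gamma n eps E]].

Definition geometric_entropy G Gamma : \bar R :=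
  lim ((fun eps : R =>
    limn_esup (fun n => ((n%:R)^-1)%:E * lne (max_separated G Gamma n eps))%E)
    @ 0^'+).

(* Positivity of the entropy does not depend on the finite generator. *)
Definition positive_geometric_entropy G : Prop :=
  finitely_generated G /\
  forall Gamma, finite_generator G Gamma -> (0 < geometric_entropy G Gamma)%E.

End metric.

(* Main.v *)
Require Import Defs.
From HB Require Import structures.
From mathcomp Require Import all_boot all_order all_algebra.
From mathcomp Require Import all_classical all_reals all_analysis.
From mathcomp Require Import lra zify.
Import Order.TTheory GRing.Theory Num.Theory.
Import numFieldNormedType.Exports.
Local Open Scope classical_set_scope.
Local Open Scope ring_scope.

(** A continuum below is a compact connected set.  Let delta be a constant of
CW-expansiveness and Gamma a finite generator.  Every continuum of diameter at
least delta / 3 is stretched beyond delta by some g in the pseudo-group, and a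
continuum of diameter more than delta contains two subcontinua, at distance at
least delta / 3 of each other and of diameter at least delta / 3: around two
points at distance more than delta, take pieces of the continuum that reach the
spheres of radius delta / 3 (boundary bumping, [subcontinuum_reaching]).  So
stretching and splitting k times yields 2 ^ k points that are pairwise told
apart.  The entropy is then at least ln 2 / (n + 1), provided that each
stretching costs at most n letters of Gamma, with n independent of the
continuum.

Uniformity in the continuum is a compactness argument: if no n worked, a limit
along an ultrafilter of bad continua would again be a continuum of diameter at
least delta / 3, and the g that stretches it would also stretch the continua
close to it ([uniform_expansion]).

The delicate point is that g is only locally a word in Gamma: on one continuum
it may be given by different words, none of which is defined on the whole
continuum, whereas the entropy counts words defined at both points.  This is
harmless because words are needed only to pull separation back.  Suppose
that g is a word w on the ball of radius r around x, and that g x, g y are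
eta-separated by a word v of length k, with eta < r.  If y is within eta of x,
then g is w at both points, and w followed by v separates x from y; otherwise
the empty word does.  In both cases x and y are eta-separated by a word of
length at most |w| + k ([near_pulls_back_separation]).  The radius r may be
much smaller than delta, but it only bounds the resolution eta at which the
points are counted, not the size of the continua that are stretched, and
positivity of the entropy may be checked at any fixed resolution
([geometric_entropy_ge]).

A nontrivial continuum to start from exists since a compact, locally connected
space without any would be discrete, hence finite. *)

Set Implicit Arguments.
Unset Strict Implicit.

(** * Metric topology *)

Lemma nbhs_distP (R : realType) (M : metricType R) (x : M) (A : set M) :
  nbhs x A <-> exists2 r : R, 0 < r & forall y, mdist x y < r -> A y.
Proof.
rewrite -metricType_numDomainType.filter_from_mdist_nbhs.
by split=> -[r r0 rA]; exists r.
Qed.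

Lemma open_dist_lt (R : realType) (M : metricType R) (x : M) (r : R) :
  open [set y | mdist x y < r].
Proof.
rewrite openE => y /= xyr; apply/nbhs_distP; exists (r - mdist x y).
  by rewrite subr_gt0.
by move=> z yz /=; have := metric_triangle x y z; lra.
Qed.

Lemma closed_dist_le (R : realType) (M : metricType R) (x : M) (r : R) :
  closed [set y | mdist x y <= r].
Proof.
move=> y clFy; rewrite /= leNgt; apply/negP => rxy.
have /clFy[z /= [xz yz]] : nbhs y [set z | mdist y z < mdist x y - r].
  by apply/nbhs_distP; exists (mdist x y - r); rewrite ?subr_gt0.
have := metric_triangle x z y; rewrite (metric_sym z y); lra.
Qed.

(** Every point of the compact set has a neighbourhood and a radius that
keep away from the closed set; compactness makes the radius uniform. *)
Lemma compact_separation (R : realType) (M : metricType R) (K F : set M) :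
  compact K -> closed F -> K `&` F = set0 ->
  exists2 r : R, 0 < r & forall x y, K x -> F y -> r <= mdist x y.
Proof.
move=> cK cF KF0.
have : forall x, K x -> \forall x' \near x & e \near (0 : R)^'+,
    forall y, F y -> e <= mdist x' y.
  move=> x Kx.
  have : nbhs x (~` F).
    apply: open_nbhs_nbhs; split; first exact: closed_openC.
    by move=> Fx; rewrite -[False]/(set0 x) -KF0.
  move=> /nbhs_distP[r r0 rF].
  exists ([set x' | mdist x x' < r / 2], [set e | e < r / 2]) => /=.
    split; last by apply: nbhs_right_lt; lra.
    by apply/nbhs_distP; exists (r / 2) => //; lra.
  move=> [x' e] /= [xx' er] y Fy; rewrite leNgt; apply/negP => x'y.
  by apply: (rF y) Fy; have := metric_triangle x x' y; lra.
move=> /((compact_near_coveringP K).1 cK) H.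
near (0 : R)^'+ => e; exists e; first by [].
by move=> x y Kx; move: y; move: x Kx; near: e; apply: H.
Unshelve. all: by end_near. Qed.

(** * Chained sets and limits of continua *)

(** Any two points are joined within the set by a chain of steps shorter than
[e].  The formulation by invariant subsets spares the chains themselves. *)
Definition chained {R : realType} {M : metricType R} (e : R) (C : set M) :=
  forall S : set M, C `&` S !=set0 ->
    (forall x y, C x -> S x -> C y -> mdist x y < e -> S y) -> C `<=` S.

Lemma connected_chained (R : realType) (M : metricType R) (e : R) (C : set M) :
  0 < e -> connected C -> chained e C.
Proof.
move=> e0 conC S CS0 Sstep.
pose O (A : set M) := \bigcup_(x in A) [set y : M | mdist x y < e].
have oO A : open (O A) by apply: bigcup_open => x _; exact: open_dist_lt.
have OS x : C x -> O (C `&` S) x -> S x.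
  by move=> Cx [z [Cz Sz] zx]; exact: Sstep Cz Sz Cx zx.
have OnS x : C x -> O (C `\` S) x -> ~ S x.
  move=> Cx [z [Cz nSz] zx] Sx; apply: nSz; apply: Sstep Cx Sx Cz _.
  by rewrite metric_sym.
have OI A x : A x -> O A x by move=> Ax; exists x => //=; rewrite mdistxx.
suff <- : C `&` S = C by move=> x [].
apply: conC => //.
- exists (O (C `&` S)) => //; apply/seteqP; split => x [Cx Sx]; split=> //.
  + exact: OI.
  + exact: OS.
- exists (~` O (C `\` S)); first exact: open_closedC.
  apply/seteqP; split => x [Cx Sx]; split=> //; first by move=> /(OnS _ Cx).
  by apply: contrapT => nSx; apply: Sx; exact: OI.
Qed.

(** The limit, for the Hausdorff distance, of the sets [C n] along [U]. *)
Definition ultralimit {R : realType} {M : metricType R}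
    (U : set_system nat) (C : nat -> set M) : set M :=
  [set x | forall r : R, 0 < r ->
    \forall n \near U, exists2 y, C n y & mdist x y < r].

Lemma ultralimit_point (R : realType) (M : metricType R)
    (U : set_system nat) (C : nat -> set M) (p : nat -> M) :
  compact [set: M] -> UltraFilter U -> (\forall n \near U, C n (p n)) ->
  exists2 x, ultralimit U C x &
    forall r : R, 0 < r -> \forall n \near U, mdist x (p n) < r.
Proof.
move=> cM UU Cp.
have UpU : UltraFilter (p @ U).
  split=> [|F FF pUF]; first exact: fmap_proper_filter.
  apply/seteqP; split => // A FA.
  have [//|UnA] := in_ultra_setVsetC (p @^-1` A) UU.
  have : F (~` A) by exact: pUF.
  by move=> /(filterI FA); rewrite setICr => /filter_not_empty.
have : (p @ U) [set: M] by exact: filterT.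
move: cM; rewrite compact_ultra => /(_ _ UpU) /[apply] -[x [_ px]].
have near_x (r : R) : 0 < r -> \forall n \near U, mdist x (p n) < r.
  move=> r0; have xr : nbhs x [set y | mdist x y < r].
    by apply/nbhs_distP; exists r.
  exact: (px _ xr).
exists x => // r r0; apply: filterS2 Cp (near_x r r0) => n Cn xpn.
by exists (p n).
Qed.

Lemma ultralimit_closed (R : realType) (M : metricType R)
    (U : set_system nat) (C : nat -> set M) :
  Filter U -> closed (ultralimit U C).
Proof.
move=> FU x clLx r r0.
have r20 : 0 < r / 2 by lra.
have [z [Lz /= xz]] : ultralimit U C `&` [set z | mdist x z < r / 2] !=set0.
  by apply: clLx; apply/nbhs_distP; exists (r / 2).
apply: filterS (Lz _ r20) => n [y Cy zy]; exists y => //.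
by have := metric_triangle x z y; lra.
Qed.

Lemma ultralimit_subset (R : realType) (M : metricType R)
    (U : set_system nat) (C : nat -> set M) (F : set M) :
  ProperFilter U -> closed F -> (forall n, C n `<=` F) ->
  ultralimit U C `<=` F.
Proof.
move=> FU cF CF x Lx; apply: cF => A /nbhs_distP[r r0 rA].
by have /filter_ex[n [y Cy xy]] := Lx r r0; exists y; split; [exact: CF Cy|exact: rA].
Qed.

(** Otherwise points of the [C n] outside [W] would accumulate at a point of the
limit outside [W]. *)
Lemma ultralimit_nbhd (R : realType) (M : metricType R)
    (U : set_system nat) (C : nat -> set M) (W : set M) :
  compact [set: M] -> UltraFilter U -> open W -> ultralimit U C `<=` W ->
  \forall n \near U, C n `<=` W.
Proof.
move=> cM UU oW LW.
have [//|UnW] := in_ultra_setVsetC [set n | C n `<=` W] UU.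
have [n0 /= /existsNP[x0 _]] : exists n, ~ (C n `<=` W) := filter_ex UnW.
have /choice[p pE] n : exists x, ~ (C n `<=` W) -> C n x /\ ~ W x.
  have [CW|/existsNP[x /not_implyP[Cx nWx]]] := pselect (C n `<=` W).
    by exists x0.
  by exists x.
have [x Lx px] : exists2 x, ultralimit U C x &
    forall r : R, 0 < r -> \forall n \near U, mdist x (p n) < r.
  by apply: ultralimit_point => //; apply: filterS UnW => n /pE[].
have /nbhs_distP[r r0 rW] : nbhs x W by apply: open_nbhs_nbhs; split=> //; exact: LW.
exfalso; near U => n.
have [_ nWp] : C n (p n) /\ ~ W (p n) by apply: pE; near: n.
by apply: nWp; apply: rW; near: n; exact: px.
Unshelve. all: by end_near. Qed.

(** A clopen splitting of the limit has two parts at positive distance r.  The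
sets near the limit lie in the (r / 3)-neighbourhoods of the two parts and meet
both, and steps shorter than r / 3 cannot pass from one to the other. *)
Lemma ultralimit_connected (R : realType) (M : metricType R)
    (U : set_system nat) (C : nat -> set M) :
  compact [set: M] -> UltraFilter U ->
  (forall e : R, 0 < e -> \forall n \near U, chained e (C n)) ->
  connected (ultralimit U C).
Proof.
move=> cM UU Cchain B [b Bb] [W oW BW] [F cF BF].
pose L := ultralimit U C; rewrite -/L in BW BF; rewrite -/L.
have cL : closed L by exact: ultralimit_closed.
have LB x : B x -> L x by rewrite BW => -[].
apply/seteqP; split => // c Lc; apply: contrapT => nBc.
have [r r0 rBc] : exists2 r : R, 0 < r &
    forall x y, B x -> (L `&` ~` W) y -> r <= mdist x y.
  apply: compact_separation.
  - apply: (@subclosed_compact _ _ [set: M]) => //.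
    by rewrite BF; exact: closedI.
  - by apply: closedI => //; exact: open_closedC.
  - by apply/seteqP; split => // x []; rewrite BW => -[_ Wx] [].
have nWc : (L `&` ~` W) c by split => // Wc; apply: nBc; rewrite BW.
have r30 : 0 < r / 3 by lra.
pose S := \bigcup_(x in B) [set y : M | mdist x y < r / 3].
pose T := \bigcup_(x in L `&` ~` W) [set y : M | mdist x y < r / 3].
have ST x y : S x -> T y -> r / 3 < mdist x y.
  move=> [x' Bx' /= xx'] [y' Ly' /= yy'].
  have := rBc _ _ Bx' Ly'.
  have := metric_triangle x' x y'; have := metric_triangle x y y'.
  by rewrite (metric_sym y y'); lra.
have oST : open (S `|` T).
  by apply: openU; apply: bigcup_open => x _; exact: open_dist_lt.
have /(ultralimit_nbhd cM UU oST) CST : ultralimit U C `<=` S `|` T.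
  move=> x Lx; have [Bx|nBx] := pselect (B x); [left|right].
    by exists x => //=; rewrite mdistxx.
  exists x => /=; last by rewrite mdistxx.
  by split => // Wx; apply: nBx; rewrite BW.
near U => n.
have Cn : C n `<=` S `|` T by near: n.
have [x Cx bx] : exists2 x, C n x & mdist b x < r / 3.
  by near: n; exact: LB b Bb _ r30.
have [y Cy cy] : exists2 y, C n y & mdist c y < r / 3.
  by near: n; exact: Lc _ r30.
have Ty : T y by exists c.
have Sx : S x by exists b.
have : S y.
  have chn : chained (r / 3) (C n) by near: n; exact: Cchain.
  apply: (chn S) Cy; first by exists x.
  move=> u v Cu Su Cv uv; have [//|Tv] := Cn _ Cv.
  by have := ST _ _ Su Tv; lra.
by move=> /ST /(_ Ty); rewrite mdistxx; lra.
Unshelve. all: by end_near. Qed.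

(** * Boundary bumping *)

(** The points that chains from [a], with steps shorter than [e] landing in
[K], can reach. *)
Definition reachable {R : realType} {M : metricType R} (e : R) (K : set M)
    (a : M) : set M :=
  [set x | forall S : set M, S a ->
    (forall y z, S y -> K z -> mdist y z < e -> S z) -> S x].

Lemma reachable_start (R : realType) (M : metricType R) (e : R) (K : set M) a :
  reachable e K a a.
Proof. by []. Qed.

Lemma reachable_step (R : realType) (M : metricType R) (e : R) (K : set M) a
    (x y : M) :
  reachable e K a x -> K y -> mdist x y < e -> reachable e K a y.
Proof.
by move=> ax Ky xy S Sa Sstep; apply: Sstep (ax S Sa Sstep) Ky xy.
Qed.

Lemma reachable_subset (R : realType) (M : metricType R) (e : R) (K : set M) a :
  K a -> reachable e K a `<=` K.
Proof. by move=> Ka x; apply => // y z _ Kz _. Qed.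

(** An invariant subset containing [a] is everything; since steps are
reversible, an invariant subset without [a] has an invariant complement, which
is everything. *)
Lemma reachable_chained (R : realType) (M : metricType R) (e : R) (K : set M) a :
  K a -> chained e (reachable e K a).
Proof.
move=> Ka S [x [ax Sx]] Sstep.
have [Sa|nSa] := pselect (S a).
  move=> y ay; suff [] : (reachable e K a `&` S) y by [].
  apply: (ay) => [|u v [au Su] Kv uv]; first by split.
  have av := reachable_step au Kv uv.
  by split => //; exact: Sstep uv.
suff [] : (reachable e K a `\` S) x by [].
apply: (ax) => [|y z [ay nSy] Kz yz]; first by split.
have az := reachable_step ay Kz yz.
split => // Sz; apply: nSy; apply: Sstep az Sz ay _.
by rewrite metric_sym.
Qed.

(** If the chains remained deep inside the closed ball, the ball constraint
would never stop them, and by connectedness of [K] they would reach [b]. *)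
Lemma reachable_escape (R : realType) (M : metricType R) (e r : R) (K : set M)
    (a b : M) : 0 < e -> 0 <= r -> connected K -> K a -> K b -> r < mdist a b ->
  exists2 x, reachable e (K `&` [set y | mdist a y <= r]) a x &
    r - e <= mdist a x.
Proof.
move=> e0 r0 conK Ka Kb rab.
apply: contrapT => /forall2NP noescape.
set K' := K `&` _ in noescape *.
have K'a : K' a by split => //=; rewrite mdistxx.
suff : reachable e K' a b by move=> /(reachable_subset K'a)[_ /=]; lra.
apply: (connected_chained e0 conK (S := reachable e K' a)) Kb => [|x y Kx ax Ky xy].
  by exists a; split => //; exact: reachable_start.
apply: reachable_step (ax) _ (xy); split => //=.
have [//|/negP] := noescape x; rewrite -ltNge => axr.
by have := metric_triangle a x y; lra.
Qed.

(** The limit, as the mesh tends to 0, of the sets reachable from [a] within the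
closed ball of radius [r] around [a]. *)
Lemma subcontinuum_reaching (R : realType) (M : metricType R) (K : set M)
    (a b : M) (r : R) :
  compact [set: M] -> compact K -> connected K -> K a -> K b ->
  0 < r -> r < mdist a b ->
  exists A : set M, [/\ compact A, connected A,
    A `<=` K `&` [set x | mdist a x <= r], A a & exists2 x, A x & r <= mdist a x].
Proof.
move=> cM cK conK Ka Kb r0 rab.
pose e n : R := n.+1%:R^-1.
have e0 n : 0 < e n by rewrite invr_gt0.
pose K' := K `&` [set x | mdist a x <= r].
have cK' : closed K'.
  by apply: closedI; [exact: compact_closed (@metric_hausdorff _ _) cK|exact: closed_dist_le].
have K'a : K' a by split => //=; rewrite mdistxx ltW.
pose C n := reachable (e n) K' a.
have CK' n : C n `<=` K' by exact: reachable_subset.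
have [U [UU oU]] := ultraFilterLemma eventually_filter.
have e_small (s : R) : 0 < s -> \forall n \near U, e n < s.
  by move=> s0; apply: oU; exact: near_infty_natSinv_lt (PosNum s0).
have /choice[p pE] n : exists x, C n x /\ r - e n <= mdist a x.
  by have [x Cx rx] := reachable_escape (e0 n) (ltW r0) conK Ka Kb rab; exists x.
have LK' : ultralimit U C `<=` K' by exact: ultralimit_subset.
exists (ultralimit U C); split => //.
- apply: (@subclosed_compact _ _ [set: M]) => //.
  exact: ultralimit_closed.
- apply: ultralimit_connected => // s s0.
  apply: filterS (e_small s s0) => n ns S CS0 Sstep.
  apply: (reachable_chained (e := e n) K'a CS0) => x y Cx Sx Cy xy.
  by apply: Sstep Cx Sx Cy _; exact: lt_trans ns.
- move=> s s0; apply: nearW => n; exists a; first exact: reachable_start.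
  by rewrite mdistxx.
- have [x Lx px] : exists2 x, ultralimit U C x &
      forall s : R, 0 < s -> \forall n \near U, mdist x (p n) < s.
    by apply: ultralimit_point => //; apply: nearW => n; have [] := pE n.
  exists x => //; rewrite leNgt; apply/negP => axr.
  pose s := (r - mdist a x) / 2; have s0 : 0 < s by rewrite /s; lra.
  near U => n.
  have [_ rp] := pE n.
  have xp : mdist x (p n) < s by near: n; exact: px.
  have en : e n < s by near: n; exact: e_small.
  by have := metric_triangle a x (p n); rewrite /s in xp en *; lra.
Unshelve. all: by end_near. Qed.

(** * Separation by words in the generators *)

Lemma word_in_cat (T : topologicalType) (Gamma : set (local_homeo T)) v w :
  word_in Gamma v -> word_in Gamma w -> word_in Gamma (v ++ w).
Proof. by elim: v => //= l v IHv [Gl Gv] Gw; split => //; exact: IHv. Qed.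

Lemma word_map_cat (T : topologicalType) (v w : seq (local_homeo T * bool)) x :
  lh_dom (word_map v) x -> lh_dom (word_map w) (word_map v x) ->
  lh_dom (word_map (v ++ w)) x /\
  word_map (v ++ w) x = word_map w (word_map v x).
Proof.
elim: v x => //= l v IHv x [lx vx] wx.
by have [? ?] := IHv _ vx wx.
Qed.

Definition word_separated {R : realType} {M : metricType R}
    (Gamma : set (local_homeo M)) (n : nat) (eta : R) (x y : M) : Prop :=
  exists w, [/\ word_in Gamma w, (size w <= n)%N, lh_dom (word_map w) x,
    lh_dom (word_map w) y & eta < mdist (word_map w x) (word_map w y)].

Lemma word_separated_leq (R : realType) (M : metricType R)
    (Gamma : set (local_homeo M)) n m (eta : R) (x y : M) :
  (n <= m)%N -> word_separated Gamma n eta x y -> word_separated Gamma m eta x y.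
Proof.
by move=> nm [w [Gw wn wx wy xy]]; exists w; split => //; exact: leq_trans nm.
Qed.

Lemma word_separated_dist (R : realType) (M : metricType R)
    (Gamma : set (local_homeo M)) n (eta : R) (x y : M) :
  eta < mdist x y -> word_separated Gamma n eta x y.
Proof. by move=> xy; exists [::]. Qed.

Lemma word_separated_word (R : realType) (M : metricType R)
    (Gamma : set (local_homeo M)) v k (eta : R) (x y : M) :
  word_in Gamma v -> lh_dom (word_map v) x -> lh_dom (word_map v) y ->
  word_separated Gamma k eta (word_map v x) (word_map v y) ->
  word_separated Gamma (size v + k) eta x y.
Proof.
move=> Gv vx vy [w [Gw wk wx wy xy]]; exists (v ++ w).
have [vwx vwxE] := word_map_cat vx wx; have [vwy vwyE] := word_map_cat vy wy.
split => //; first exact: word_in_cat.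
- by rewrite size_cat leq_add2l.
- by rewrite vwxE vwyE.
Qed.

(** The expanding map [g] acts on orbits at [x] as if it were a word of length
[n], for the purpose of separating points.  The scale 1 / (n + 1) makes the
property monotone in [n], so that a single integer controls both the number of
letters and the resolution. *)
Definition pulls_back_separation {R : realType} {M : metricType R}
    (Gamma : set (local_homeo M)) (g : local_homeo M) (n : nat) (x : M) : Prop :=
  forall y k (eta : R), lh_dom g y -> eta <= n.+1%:R^-1 ->
    word_separated Gamma k eta (g x) (g y) -> word_separated Gamma (n + k) eta x y.

Lemma pulls_back_separation_leq (R : realType) (M : metricType R)
    (Gamma : set (local_homeo M)) (g : local_homeo M) n m (x : M) :
  (n <= m)%N ->
  pulls_back_separation Gamma g n x -> pulls_back_separation Gamma g m x.
Proof.
move=> nm gn y k eta gy etam sepg.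
apply: word_separated_leq (_ : (n + k <= m + k)%N) _; first by rewrite leq_add2r.
apply: gn => //; apply: le_trans etam _.
by rewrite lef_pV2 ?posrE// ler_nat.
Qed.

(** Near [x] the map [g] is a word [w].  A point [y] that is too far from [x']
for [g] to be [w] at [y] is separated from [x'] by the empty word. *)
Lemma near_pulls_back_separation (R : realType) (M : metricType R)
    (Gamma : set (local_homeo M)) (g : local_homeo M) (x : M) :
  generated_by Gamma g -> lh_dom g x ->
  \forall x' \near x & n \near \oo, pulls_back_separation Gamma g n x'.
Proof.
move=> Gg /Gg[w [Gw /nbhs_distP[r r0 gw]]].
have r20 : 0 < r / 2 by lra.
exists ([set x' | mdist x x' < r / 2],
        [set n | (size w <= n)%N /\ n.+1%:R^-1 < r / 2]) => /=.
  split; first by apply/nbhs_distP; exists (r / 2).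
  near=> n; split; near: n; first exact: nbhs_infty_ge.
  exact: near_infty_natSinv_lt (PosNum r20).
move=> [x' n] /= [xx' [wn nr]] y k eta gy etan sepg.
have [etax'y|x'yeta] := ltP eta (mdist x' y); first exact: word_separated_dist.
have [_ wx' gx'] : [/\ lh_dom g x', lh_dom (word_map w) x' & g x' = word_map w x'].
  by apply: gw; lra.
have [_ wy gy'] : [/\ lh_dom g y, lh_dom (word_map w) y & g y = word_map w y].
  have := le_lt_trans (le_trans x'yeta etan) nr.
  by move=> ?; apply: gw; have := metric_triangle x x' y; lra.
apply: word_separated_leq (_ : (size w + k <= n + k)%N) _.
  by rewrite leq_add2r.
by apply: word_separated_word => //; rewrite -gx' -gy'.
Unshelve. all: by end_near. Qed.

Lemma diam_gtP (R : realType) (M : metricType R) (A : set M) (delta : R) :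
  (delta%:E < diam A)%E -> exists x y, [/\ A x, A y & delta < mdist x y].
Proof.
by move=> /ereal_sup_gt[_ [[x y] [/= Ax Ay] <-]]; rewrite lte_fin; exists x, y.
Qed.

(** * Uniform expansion of continua *)

(** CW-expansiveness with a given constant. *)
Definition expanding {R : realType} {M : metricType R} (delta : R)
    (G : set (local_homeo M)) : Prop :=
  forall C : set M, compact C -> connected C ->
    (exists x y, [/\ C x, C y & x <> y]) ->
    exists g, [/\ G g, C `<=` lh_dom g & (delta%:E < diam (g @` C))%E].

(** If every [n] had a bad continuum [C n], the limit of the [C n] would be a
continuum with two points at distance at least [eps], stretched by some [g].
That [g] is defined on the [C n] close to the limit, stretches them as well, and
pulls separation back on a whole neighbourhood of the limit, by compactness. *)
Lemma uniform_expansion (R : realType) (M : metricType R)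
    (Gamma : set (local_homeo M)) (delta eps : R) :
  compact [set: M] -> 0 < eps -> expanding delta (generated_by Gamma) ->
  exists n, forall (C : set M) x y,
    compact C -> connected C -> C x -> C y -> eps <= mdist x y ->
    exists g, [/\ C `<=` lh_dom g,
      exists u v, [/\ C u, C v & delta < mdist (g u) (g v)] &
      C `<=` pulls_back_separation Gamma g n].
Proof.
move=> cM eps0 expG; apply: contrapT => /forallNP nounif.
pose bad n (c : set M * (M * M)) := [/\ connected c.1, c.1 c.2.1, c.1 c.2.2,
  eps <= mdist c.2.1 c.2.2 &
  ~ exists g, [/\ c.1 `<=` lh_dom g,
      exists u v, [/\ c.1 u, c.1 v & delta < mdist (g u) (g v)] &
      c.1 `<=` pulls_back_separation Gamma g n]].
have /choice[c badc] n : exists c, bad n c.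
  apply: contrapT => /forallNP nobad; apply: (nounif n) => C x y cC conC Cx Cy xy.
  by apply: contrapT => nog; apply: (nobad (C, (x, y))).
pose C n := (c n).1; pose p n := (c n).2.1; pose q n := (c n).2.2.
have conC n : connected (C n) by have [] := badc n.
have Cp n : C n (p n) by have [] := badc n.
have Cq n : C n (q n) by have [] := badc n.
have pq n : eps <= mdist (p n) (q n) by have [] := badc n.
have [U [UU oU]] := ultraFilterLemma eventually_filter.
have [x Lx px] := ultralimit_point cM UU (nearW _ Cp).
have [y Ly qy] := ultralimit_point cM UU (nearW _ Cq).
have conL : connected (ultralimit U C).
  by apply: ultralimit_connected => // e e0; apply: nearW => n; exact: connected_chained.
have cL : compact (ultralimit U C).
  by apply: (@subclosed_compact _ _ [set: M]) => //; exact: ultralimit_closed.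
have xy : x <> y.
  move=> xyE; rewrite -{y}xyE in Ly qy.
  have e20 : 0 < eps / 2 by lra.
  near U => n.
  have xp : mdist x (p n) < eps / 2 by near: n; exact: px.
  have xq : mdist x (q n) < eps / 2 by near: n; exact: qy.
  have := metric_triangle (p n) x (q n); rewrite (metric_sym (p n) x).
  by have := pq n; lra.
have [|g [Gg Lg /diam_gtP[_ [_ [[u Lu <-] [v Lv <-] uv]]]]] := expG _ cL conL.
  by exists x, y.
have /filter_ex[n0 Ln0] : \forall n \near \oo, ultralimit U C `<=`
    (fun z => nbhs z (pulls_back_separation Gamma g n)).
  move/compact_near_coveringP : (cL); apply=> z Lz.
  have [[A B] /= [zA oB] ABg] := near_pulls_back_separation Gg (Lg z Lz).
  exists (A^°, B) => /=; first by split => //; exact: nbhs_interior.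
  move=> [z' n] /= [Az' Bn]; apply: filterS Az' => z'' Az''.
  exact: (ABg (z'', n)).
have gcont z (s : R) : ultralimit U C z -> 0 < s ->
    \forall n \near U, exists2 z', C n z' & mdist (g z) (g z') < s.
  move=> Lz s0; have [r r0 rg] : exists2 r : R, 0 < r &
      forall z', mdist z z' < r -> (lh_dom g `&` g @^-1` [set t | mdist (g z) t < s]) z'.
    apply/nbhs_distP; apply: open_nbhs_nbhs; split.
      exact: open_preimage_within (lh_dom_open g) (@lh_fun_cont _ g) (open_dist_lt _ _).
    by split; [exact: Lg|rewrite /= mdistxx].
  by apply: filterS (Lz r r0) => n [z' Cz' /rg[_ zz']]; exists z'.
pose s := (mdist (g u) (g v) - delta) / 2.
have s0 : 0 < s by rewrite /s; lra.
near U => n; have [_ _ _ _] := badc n; apply.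
exists g; split.
- by near: n; apply: ultralimit_nbhd => //; exact: lh_dom_open.
- have [u' Cu' uu'] : exists2 u', C n u' & mdist (g u) (g u') < s.
    by near: n; exact: gcont.
  have [v' Cv' vv'] : exists2 v', C n v' & mdist (g v) (g v') < s.
    by near: n; exact: gcont.
  exists u', v'; split => //; rewrite /s in uu' vv'.
  have := metric_triangle (g u) (g u') (g v).
  have := metric_triangle (g u') (g v') (g v).
  by rewrite (metric_sym (g v') (g v)); lra.
- have n0n : (n0 <= n)%N by near: n; apply: oU; exact: nbhs_infty_ge.
  suff Cn : C n `<=` (pulls_back_separation Gamma g n0)^°.
    move=> z /Cn/interior_subset; exact: pulls_back_separation_leq.
  by near: n; apply: ultralimit_nbhd => //; exact: open_interior.
Unshelve. all: by end_near. Qed.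

(** * Exponential growth of separated families *)

(** Otherwise the connected neighbourhoods of the points are singletons, and
the space is discrete.  The filter of cofinite sets of an infinite discrete
space has no cluster point. *)
Lemma nontrivial_continuum (R : realType) (M : metricType R) :
  compact [set: M] -> infinite_set [set: M] -> locally_connected M ->
  exists C x y, [/\ compact C, connected C, C x, C y & x <> y :> M].
Proof.
move=> cM infM lcM; apply: contrapT => trivial.
have open1 (x : M) : open [set x].
  have [U [oU conU Ux _]] := lcM x setT filterT.
  suff <- : U = [set x] by [].
  apply/seteqP; split => [y Uy|_ -> //]; apply: contrapT => xy.
  apply: trivial; exists (closure U), y, x; split => //.
  - by apply: (@subclosed_compact _ _ [set: M]) => //; exact: closed_closure.
  - exact: connected_closure.
  - exact: subset_closure.
  - exact: subset_closure.
pose cofinite := [set A : set M | finite_set (~` A)].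
have cofinite_proper : ProperFilter cofinite.
  apply: Build_ProperFilter_ex => [A finA|].
    apply: contrapT => /forallNP A0; apply: infM; apply: sub_finite_set finA.
    by move=> x _; exact: A0.
  split=> [|A B finA finB|A B AB]; rewrite /cofinite /=.
  - by rewrite setCT; exact: finite_set0.
  - by rewrite setCI finite_setU.
  - by apply: sub_finite_set; exact: subsetC.
have [|x [_ /(_ (~` [set x]) [set x])]] := cM cofinite cofinite_proper.
  by rewrite /cofinite /= setCT; exact: finite_set0.
case=> [||y [] //]; first by rewrite /cofinite /= setCK; exact: finite_set1.
by apply: open_nbhs_nbhs; split.
Qed.

(** Stretch [C] by [g], pick two distant subcontinua [A] and [B] of [g @` C],
and pull the families given by induction in [A] and [B] back by [g]: points of
the same family are separated by induction, points of different families by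
their distance. *)
Lemma separated_families (R : realType) (M : metricType R)
    (Gamma : set (local_homeo M)) (delta : R) :
  compact [set: M] -> 0 < delta -> expanding delta (generated_by Gamma) ->
  exists n, exists2 eta : R, 0 < eta &
    forall k (C : set M) x y,
      compact C -> connected C -> C x -> C y -> delta / 3 <= mdist x y ->
      exists e : nat -> M, (forall i, (i < 2 ^ k)%N -> C (e i)) /\
        forall i j, (i < j < 2 ^ k)%N -> word_separated Gamma (n * k) eta (e i) (e j).
Proof.
move=> cM delta0 expG.
have delta30 : 0 < delta / 3 by lra.
have [n unif] := uniform_expansion cM delta30 expG.
pose eta := Num.min n.+1%:R^-1 (delta / 4).
have etan : eta <= n.+1%:R^-1 by rewrite ge_min lexx.
have etad : eta < delta / 3.
  by apply: le_lt_trans (_ : delta / 4 < _); [rewrite ge_min lexx orbT|lra].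
exists n, eta; first by rewrite lt_min invr_gt0 ltr0n/=; lra.
elim=> [|k IHk] C x y cC conC Cx Cy xy.
  by exists (fun=> x); split => // i j; rewrite expn0; lia.
have [g [Cg [u [v [Cu Cv uv]]] Cpull]] := unif C x y cC conC Cx Cy xy.
have gcont : {within C, continuous g}.
  exact: continuous_subspaceW Cg (@lh_fun_cont _ g).
have cgC : compact (g @` C) by exact: continuous_compact.
have congC : connected (g @` C) by exact: connected_continuous_connected.
have gCu : (g @` C) (g u) by exists u.
have gCv : (g @` C) (g v) by exists v.
have duv : delta / 3 < mdist (g u) (g v) by lra.
have dvu : delta / 3 < mdist (g v) (g u) by rewrite metric_sym.
have [A [cA conA AgC Au [a Aa ua]]] :=
  subcontinuum_reaching cM cgC congC gCu gCv delta30 duv.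
have [B [cB conB BgC Bv [b Bb vb]]] :=
  subcontinuum_reaching cM cgC congC gCv gCu delta30 dvu.
have AB z t : A z -> B t -> eta < mdist z t.
  move=> /AgC[_ /= uz] /BgC[_ /= vt].
  have := metric_triangle (g u) z (g v); have := metric_triangle z t (g v).
  by rewrite (metric_sym t); lra.
have [eA [eAin eAsep]] := IHk A _ _ cA conA Au Aa ua.
have [eB [eBin eBsep]] := IHk B _ _ cB conB Bv Bb vb.
(* The family of [A] followed by that of [B], to be pulled back by [g]. *)
pose f i := if (i < 2 ^ k)%N then eA i else eB (i - 2 ^ k)%N.
have half i : (i < 2 ^ k.+1)%N -> (i < 2 ^ k)%N = false -> (i - 2 ^ k < 2 ^ k)%N.
  by rewrite expnS; lia.
have fin i : (i < 2 ^ k.+1)%N -> (g @` C) (f i).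
  move=> ik; rewrite /f; case: ifPn => [/eAin/AgC[]//|/negbTE /(half i ik)].
  by move=> /eBin/BgC[].
have fsep i j : (i < j < 2 ^ k.+1)%N -> word_separated Gamma (n * k) eta (f i) (f j).
  move=> /andP[ij jk]; rewrite /f; case: ifPn => ik; case: ifPn => jk'.
  - by apply: eAsep; rewrite ij.
  - apply/word_separated_dist/AB; first exact: eAin.
    by apply/eBin/half => //; exact/negbTE.
  - by exfalso; lia.
  - apply: eBsep; rewrite half//; last exact/negbTE.
    by rewrite andbT; lia.
exists (lh_invfun g \o f); split => [i /fin[c Cc cE]|i j /andP[ij jk]] /=.
  by rewrite -cE lh_funK//; exact: Cg.
have [c Cc cE] := fin i (ltn_trans ij jk).
have [d Cd dE] := fin _ jk.
rewrite -cE -dE !lh_funK; [|exact: Cg..].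
rewrite mulnS; apply: Cpull => //; first exact: Cg.
by rewrite cE dE; apply: fsep; rewrite ij.
Qed.

(** * Entropy *)

Lemma word_map_generated (T : topologicalType) (Gamma : set (local_homeo T)) w :
  word_in Gamma w -> generated_by Gamma (word_map w).
Proof.
move=> Gw x wx; exists w; split => //.
have : nbhs x (lh_dom (word_map w)).
  by apply: open_nbhs_nbhs; split => //; exact: lh_dom_open.
exact: filterS.
Qed.

Lemma word_separated_pts (R : realType) (M : metricType R)
    (Gamma : set (local_homeo M)) n (eta : R) (x y : M) :
  word_separated Gamma n eta x y ->
  separated_pts (generated_by Gamma) Gamma n eta x y.
Proof.
move=> [w [Gw wn wx wy xy]]; exists (word_map w); split => //.
  exact: word_map_generated.
have comp_w : composition_of Gamma (word_map w) (size w) by exists w; split.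
have exk : exists k, `[< composition_of Gamma (word_map w) k >].
  by exists (size w); exact/asboolP.
have [k /asboolP comp_k mink] := ex_minnP exk.
exists k; first by split => // j comp_j; apply: mink; exact/asboolP.
by apply: leq_trans wn; apply: mink; exact/asboolP.
Qed.

Local Open Scope ereal_scope.

Lemma max_separated_ge (R : realType) (M : metricType R)
    (G Gamma : set (local_homeo M)) n (eta : R) N (e : nat -> M) :
  (0 <= eta)%R ->
  (forall i j, (i < j < N)%N -> separated_pts G Gamma n eta (e i) (e j)) ->
  N%:R%:E <= max_separated G Gamma n eta.
Proof.
move=> eta0 esep.
have sepxx x : ~ separated_pts G Gamma n eta x x.
  by move=> [g [_ _ _ _]]; rewrite mdistxx ltNge eta0.
have sepC x y : separated_pts G Gamma n eta x y -> separated_pts G Gamma n eta y x.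
  by move=> [g [Gg gx gy gk gxy]]; exists g; split; rewrite // metric_sym.
apply: ereal_sup_ubound; exists N => //=; exists (e @` `I_N); split.
  apply: inj_card_eq => i j; rewrite !inE /= => iN jN eij.
  case: (ltngtP i j) => // ij; exfalso.
    by apply: (sepxx (e i)); rewrite {2}eij; apply: esep; rewrite ij.
  by apply: (sepxx (e i)); rewrite {1}eij; apply: esep; rewrite ij.
move=> _ _ [i /= iN <-] [j /= jN <-] eij.
case: (ltngtP i j) => [ij|ji|ijE].
- by apply: esep; rewrite ij.
- by apply/sepC/esep; rewrite ji.
- by case: eij; rewrite ijE.
Qed.

Lemma max_separated_ge0 (R : realType) (M : metricType R)
    (G Gamma : set (local_homeo M)) n (eta : R) :
  0 <= max_separated G Gamma n eta.
Proof.
apply: ereal_sup_ubound; exists 0%N => //=; exists set0; split => //.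
by rewrite II0.
Qed.

Lemma max_separated_nonincreasing (R : realType) (M : metricType R)
    (G Gamma : set (local_homeo M)) n (eta eta' : R) :
  (eta <= eta')%R -> max_separated G Gamma n eta' <= max_separated G Gamma n eta.
Proof.
move=> le_eta; apply: ereal_sup_le => _ [k [E [cardE Esep]] <-].
exists k => //; exists E; split => // x y Ex Ey /(Esep x y Ex Ey).
by move=> [g [Gg gx gy gk gxy]]; exists g; split => //; exact: le_lt_trans gxy.
Qed.

Lemma le_limn_esup (R : realType) (u v : (\bar R)^nat) :
  (forall n, u n <= v n) -> limn_esup u <= limn_esup v.
Proof.
move=> uv; apply: le_ereal_inf_tmp => _ [V oV <-].
apply: (@le_trans _ _ (ereal_sup (u @` V))).
  by apply: ereal_inf_lbound; exists V.
apply: ge_ereal_sup => _ [n Vn <-]; apply: le_trans (uv n) _.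
by apply: ereal_sup_ubound; exists n.
Qed.

Lemma limn_esup_ge (R : realType) (u : (\bar R)^nat) (c : \bar R) :
  (forall m, exists2 n, (m <= n)%N & c <= u n) -> c <= limn_esup u.
Proof.
move=> cu; apply: le_ereal_inf_tmp => _ [V [m _ mV] <-].
have [n mn cun] := cu m; apply: le_trans cun _.
by apply: ereal_sup_ubound; exists n => //; exact: mV.
Qed.

(** The growth rate is monotone in the resolution, so that the limit exists and
is at least the rate at any fixed resolution. *)
Lemma geometric_entropy_ge (R : realType) (M : metricType R)
    (G Gamma : set (local_homeo M)) (eta : R) (c : \bar R) :
  (0 < eta)%R ->
  c <= limn_esup (fun n => (n%:R^-1)%:E * lne (max_separated G Gamma n eta)) ->
  c <= geometric_entropy G Gamma.
Proof.
move=> eta0 ceta.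
pose f (eps : R) :=
  limn_esup (fun n => (n%:R^-1)%:E * lne (max_separated G Gamma n eps)).
have fmono (eps eps' : R) : (eps <= eps')%R -> f eps' <= f eps.
  move=> le_eps; apply: le_limn_esup => n; apply: lee_wpmul2l.
    by rewrite lee_fin invr_ge0.
  rewrite lee_lne ?in_itv/= ?max_separated_ge0 ?leey//.
  exact: max_separated_nonincreasing.
apply: lime_ge.
  apply: nonincreasing_at_right_is_cvge; apply: nearW => r x y _ _.
  exact: fmono.
near=> eps; apply: le_trans ceta _; apply: fmono.
by near: eps; apply: nbhs_right_le.
Unshelve. all: by end_near. Qed.

Local Close Scope ereal_scope.

Unset Implicit Arguments.

Theorem theorem2 (R : realType) (M : metricType R)
    (Mcompact : compact [set: M]) (Minfinite : infinite_set [set: M])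
    (Mlconn : locally_connected M)
    (G : set (local_homeo M)) (Gpseudo : pseudogroup G)
    (Gfg : finitely_generated G) (Gcw : cw_expansive G) :
  positive_geometric_entropy G.
Proof.
split => // Gamma [_ _ _ GE].
case: Gcw => d d0 dexp.
have dexpG : expanding d (generated_by Gamma) by rewrite -GE.
have [C0 [x0 [y0 [cC0 conC0 C0x C0y xy0]]]] :=
  nontrivial_continuum Mcompact Minfinite Mlconn.
have [g [_ C0g /diam_gtP[_ [_ [[u C0u <-] [v C0v <-] uv]]]]] : exists g,
    [/\ G g, C0 `<=` lh_dom g & (d%:E < diam (g @` C0))%E].
  by apply: dexp => //; exists x0, y0.
(* The nontrivial continuum may be tiny, but its stretched image is wide enough
   to start the construction. *)
pose C := g @` C0.
have gcont : {within C0, continuous g}.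
  exact: continuous_subspaceW C0g (@lh_fun_cont _ g).
have cC : compact C by exact: continuous_compact.
have conC : connected C by exact: connected_continuous_connected.
have Cu : C (g u) by exists u.
have Cv : C (g v) by exists v.
have duv : d / 3 <= mdist (g u) (g v) by lra.
have [n [eta eta0 famC]] := separated_families Mcompact d0 dexpG.
have growth k : ((2 ^ k)%:R%:E <= max_separated G Gamma (n.+1 * k) eta)%E.
  have [e [_ esep]] := famC k C _ _ cC conC Cu Cv duv.
  apply: (max_separated_ge (e := e)) => [|i j ij]; first exact: ltW.
  rewrite GE; apply: word_separated_pts.
  apply: word_separated_leq (esep i j ij).
  by rewrite leq_mul2r leqnSn orbT.
apply: (@lt_le_trans _ _ (ln 2 / n.+1%:R)%:E).
  by rewrite lte_fin divr_gt0// ln_gt0// ltr1n.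
apply: geometric_entropy_ge eta0 _; apply: limn_esup_ge => m.
(* Each block of n + 1 letters doubles the lower bound of [growth]; with n
   instead of n + 1 the rate would be ln 2 / 0 when n = 0. *)
exists (n.+1 * m.+1)%N; first lia.
have : (lne (2 ^ m.+1)%:R%:E <= lne (max_separated G Gamma (n.+1 * m.+1) eta))%E.
  by rewrite lee_lne ?in_itv/= ?max_separated_ge0 ?leey ?lee_fin ?ler0n.
rewrite lne_EFin ?ltr0n ?expn_gt0//.
move=> /(@lee_wpmul2l _ ((n.+1 * m.+1)%:R^-1)%:E _).
rewrite lee_fin invr_ge0 ler0n => /(_ isT); apply: le_trans.
rewrite -EFinM lee_fin natrX lnXn// -(mulr_natr (ln 2)) natrM.
have m0 : m.+1%:R != 0 :> R by rewrite pnatr_eq0.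
rewrite le_eqVlt; apply/orP; left; apply/eqP.
by rewrite invfM [RHS]mulrACA mulVf// mulr1 mulrC.
Qed.
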